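(* Let $\mathcal{R}$ be a predicative recursive TRS in the sense of $>_{pop_{ps}}$ (i.e. a constructor TRS with $l>_{pop_{ps}}r$ for all rules, for some safe mapping and admissible precedence). Then there is a polynomial $p$, depending only on $\mathcal{R}$ and the signature $\mathcal{F}$, such that for every basic term $f(u_1,\dots,u_m;v_1,\dots,v_n)$ its innermost derivation height is at most $p(\max_{i=1}^m\mathrm{depth}(u_i))$, where $u_1,\dots,u_m$ are the arguments at normal positions.
   Context: Finite signature $\mathcal{F}$ split into defined symbols $\mathcal{D}$ and constructors $\mathcal{C}$; values: variables and $c(v_1..v_n)$ with $c\in\mathcal{C}$, $v_i$ values; basic terms $f(v_1..v_n)$ with $f\in\mathcal{D}$, $v_i$ values. Constructor TRS: finite set of rules whose left-hand sides are basic terms. Innermost rewriting contracts a redex only if its arguments are normal forms; innermost derivation height = maximal length of an innermost rewrite sequence from the term. $\mathrm{depth}(x)=1$, $\mathrm{depth}(f(t_1..t_n))=1+\max\mathrm{depth}(t_i)$ (max of empty set $0$). Safe mapping: safe positions per symbol, others normal, constructors all safe; notation $f(s_1..s_k;s_{k+1}..s_{k+l})$. Precedence: preorder $\succeq$ ($\succ,\sim$); admissible if $f\sim g$ implies both defined or both constructors. $\approx_s$: $s=t$, or $f\sim g$ of equal arity with $s_i\approx_s t_{\pi(i)}$ for a permutation $\pi$ preserving safe/normal status. $G_\downarrow=\{g\mid f\succ g, f\in G\}$; $\mathcal{T}(G',\mathcal{V})$; $\mathrm{Fun}(s)$. $>_{sq}$: $s=f(\ldots)>_{sq}t$ iff (1)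 $s_i\geqslant_{sq}t$ some $i$, normal if $f\in\mathcal{D}$; or (2) $f\in\mathcal{D}$, $t=g(t_1..t_p)$, $f\succ g$, $s>_{sq}t_j$ all $j$. $>_{pop_{ps}}$: for $s=f(s_1..s_k;s_{k+1}..s_{k+l})$, $s>_{pop_{ps}}t$ iff (1) $s_i\geqslant_{pop_{ps}}t$ some $i$; (2) $f\in\mathcal{D}$, $t=g(t_1..t_m;t_{m+1}..t_{m+n})$, $f\succ g$, $s>_{sq}t_j$ ($j\leqslant m$), $s>_{pop_{ps}}t_j$ ($j>m$), and $t_j\notin\mathcal{T}(\mathrm{Fun}(s)_\downarrow,\mathcal{V})$ for at most one $j>m$; (3) $f\in\mathcal{D}$, $t$ as before, $f\sim g$, $\{s_1..s_k\}>^{mul}_{pop_{ps}}\{t_1..t_m\}$ (multiset extension modulo $\approx_s$), and for all $j>m$: $s>_{pop_{ps}}t_j$ and $t_j\in\mathcal{T}(\mathrm{Fun}(s)_\downarrow,\mathcal{V})$. Weak versions add $\approx_s$.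
   Formalization: The precedence is additionally required to place no constructor strictly above a defined symbol; without this, with c ≻ f, the rules f(c(x);y) → f(x;f(x;y)) and f(0;y) → y are oriented but have exponential innermost derivation height. *)

(* Defs.v *)
From HB Require Import structures.
From mathcomp Require Import all_boot all_algebra.
From Stdlib Require List.
From Stdlib Require Import Permutation.

Set Implicit Arguments.
Unset Strict Implicit.
Unset Printing Implicit Defensive.

(* Symbols outside [defined] are the constructors. *)
Record signature := Signature {
  symbol :> finType;
  arity : symbol -> nat;
  defined : {set symbol}
}.

Inductive term (F : signature) : Type :=
| Var of nat
| App (f : F) of {ffun 'I_(arity f) -> term F}.

Arguments Var {F}.
Arguments App {F}.

Fixpoint depth (F : signature) (t : term F) : nat :=
  match t with
  | Var _ => 1
  | App f ts => 1 + \max_i depth (ts i)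
  end.

Fixpoint Fun (F : signature) (t : term F) : {set F} :=
  match t with
  | Var _ => set0
  | App f ts => f |: \bigcup_i Fun (ts i)
  end.

(* t \in T(G, V) *)
Fixpoint term_over (F : signature) (G : {set F}) (t : term F) : bool :=
  match t with
  | Var _ => true
  | App f ts => (f \in G) && [forall i, term_over G (ts i)]
  end.

Fixpoint value (F : signature) (t : term F) : bool :=
  match t with
  | Var _ => true
  | App c ts => (c \notin defined F) && [forall i, value (ts i)]
  end.

Definition basic (F : signature) (t : term F) : bool :=
  match t with
  | Var _ => false
  | App f ts => (f \in defined F) && [forall i, value (ts i)]
  end.

Fixpoint subst (F : signature) (sigma : nat -> term F) (t : term F) : term F :=
  match t with
  | Var x => sigma x
  | App f ts => App f [ffun i => subst sigma (ts i)]
  end.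

Definition replace_arg (F : signature) (f : F)
    (ts : {ffun 'I_(arity f) -> term F}) (i : 'I_(arity f)) (u : term F) :
    {ffun 'I_(arity f) -> term F} :=
  [ffun j => if j == i then u else ts j].

Definition trs (F : signature) := seq (term F * term F).

Definition constructor_trs (F : signature) (R : trs F) : Prop :=
  forall l r, List.In (l, r) R -> basic l.

Inductive rewrite_step (F : signature) (R : trs F) : term F -> term F -> Prop :=
| rewrite_root l r sigma :
    List.In (l, r) R -> rewrite_step R (subst sigma l) (subst sigma r)
| rewrite_arg f (ts : {ffun 'I_(arity f) -> term F}) i u :
    rewrite_step R (ts i) u ->
    rewrite_step R (App f ts) (App f (replace_arg ts i u)).

Definition normal_form (F : signature) (R : trs F) (t : term F) : Prop :=
  forall u, ~ rewrite_step R t u.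

Inductive innermost_step (F : signature) (R : trs F) :
    term F -> term F -> Prop :=
| innermost_root f (ls : {ffun 'I_(arity f) -> term F}) r sigma :
    List.In (App f ls, r) R ->
    (forall i, normal_form R (subst sigma (ls i))) ->
    innermost_step R (subst sigma (App f ls)) (subst sigma r)
| innermost_arg f (ts : {ffun 'I_(arity f) -> term F}) i u :
    innermost_step R (ts i) u ->
    innermost_step R (App f ts) (App f (replace_arg ts i u)).

Inductive innermost_steps (F : signature) (R : trs F) :
    nat -> term F -> term F -> Prop :=
| innermost_steps0 t : innermost_steps R 0 t t
| innermost_stepsS n t u v :
    innermost_step R t u -> innermost_steps R n u v ->
    innermost_steps R n.+1 t v.

Definition is_innermost_height (F : signature) (R : trs F) (t : term F)
    (h : nat) : Prop :=
  (exists u, innermost_steps R h t u) /\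
  (forall n u, innermost_steps R n t u -> n <= h).

Record safe_mapping (F : signature) := SafeMapping {
  safe : forall f : F, {set 'I_(arity f)};
  safe_constructor : forall c : F, c \notin defined F -> safe c = setT
}.

Record precedence (F : signature) := Precedence {
  prec_ge : rel F;
  prec_refl : reflexive prec_ge;
  prec_trans : transitive prec_ge
}.

Definition prec_gt (F : signature) (P : precedence F) : rel F :=
  fun f g => prec_ge P f g && ~~ prec_ge P g f.

Definition prec_eq (F : signature) (P : precedence F) : rel F :=
  fun f g => prec_ge P f g && prec_ge P g f.

Definition admissible (F : signature) (P : precedence F) : Prop :=
  forall f g : F, prec_eq P f g -> (f \in defined F) = (g \in defined F).

(* Not part of admissibility.  Without it [below P (Fun l)] may contain the root
   of l: with c above f, the rules f(c(x);y) -> f(x;f(x;y)) and f(0;y) -> y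
   are oriented by [gt_pop_ps], but have exponential innermost height. *)
Definition constructors_not_above_defined (F : signature) (P : precedence F) :
    Prop :=
  forall c f : F, c \notin defined F -> f \in defined F -> ~~ prec_gt P c f.

Definition below (F : signature) (P : precedence F) (G : {set F}) : {set F} :=
  [set g | [exists f in G, prec_gt P f g]].

(* A bijection between the argument positions encodes both the equality of the
   arities and the permutation. *)
Inductive safe_equiv (F : signature) (S : safe_mapping F) (P : precedence F) :
    term F -> term F -> Prop :=
| safe_equiv_refl t : safe_equiv S P t t
| safe_equiv_perm f g (ss : {ffun 'I_(arity f) -> term F})
    (ts : {ffun 'I_(arity g) -> term F}) (pi : 'I_(arity f) -> 'I_(arity g)) :
    prec_eq P f g ->
    bijective pi ->
    (forall i, (pi i \in safe S g) = (i \in safe S f)) ->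
    (forall i, safe_equiv S P (ss i) (ts (pi i))) ->
    safe_equiv S P (App f ss) (App g ts).

(* Multiset extension of [gt] modulo [eqv]; multisets are represented by
   lists. *)
Definition multiset_gt (T : Type) (eqv gt : T -> T -> Prop) (M N : seq T) :
    Prop :=
  exists X Y Z Z' : seq T,
    [/\ Permutation M (X ++ Z), Permutation N (Y ++ Z'), List.Forall2 eqv Z Z',
        X <> [::]
      & forall y, List.In y Y -> exists2 x, List.In x X & gt x y].

Definition normal_args (F : signature) (S : safe_mapping F) (f : F)
    (ts : {ffun 'I_(arity f) -> term F}) : seq (term F) :=
  [seq ts i | i <- enum (~: safe S f)].

Inductive gt_sq (F : signature) (S : safe_mapping F) (P : precedence F) :
    term F -> term F -> Prop :=
| gt_sq_arg f (ss : {ffun 'I_(arity f) -> term F}) t i :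
    (f \in defined F -> i \notin safe S f) ->
    (gt_sq S P (ss i) t \/ safe_equiv S P (ss i) t) ->
    gt_sq S P (App f ss) t
| gt_sq_below f (ss : {ffun 'I_(arity f) -> term F})
    g (ts : {ffun 'I_(arity g) -> term F}) :
    f \in defined F ->
    prec_gt P f g ->
    (forall j, gt_sq S P (App f ss) (ts j)) ->
    gt_sq S P (App f ss) (App g ts).

Inductive gt_pop_ps (F : signature) (S : safe_mapping F) (P : precedence F) :
    term F -> term F -> Prop :=
| gt_pop_ps_arg f (ss : {ffun 'I_(arity f) -> term F}) t i :
    (gt_pop_ps S P (ss i) t \/ safe_equiv S P (ss i) t) ->
    gt_pop_ps S P (App f ss) t
| gt_pop_ps_below f (ss : {ffun 'I_(arity f) -> term F})
    g (ts : {ffun 'I_(arity g) -> term F}) :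
    f \in defined F ->
    prec_gt P f g ->
    (forall j, j \notin safe S g -> gt_sq S P (App f ss) (ts j)) ->
    (forall j, j \in safe S g -> gt_pop_ps S P (App f ss) (ts j)) ->
    (forall j1 j2, j1 \in safe S g -> j2 \in safe S g ->
       ~~ term_over (below P (Fun (App f ss))) (ts j1) ->
       ~~ term_over (below P (Fun (App f ss))) (ts j2) -> j1 = j2) ->
    gt_pop_ps S P (App f ss) (App g ts)
| gt_pop_ps_equiv f (ss : {ffun 'I_(arity f) -> term F})
    g (ts : {ffun 'I_(arity g) -> term F}) :
    f \in defined F ->
    prec_eq P f g ->
    multiset_gt (safe_equiv S P) (gt_pop_ps S P)
      (normal_args S ss) (normal_args S ts) ->
    (forall j, j \in safe S g -> gt_pop_ps S P (App f ss) (ts j)) ->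
    (forall j, j \in safe S g ->
       term_over (below P (Fun (App f ss))) (ts j)) ->
    gt_pop_ps S P (App f ss) (App g ts).

Definition predicative_recursive (F : signature) (S : safe_mapping F)
    (P : precedence F) (R : trs F) : Prop :=
  constructor_trs R /\ forall l r, List.In (l, r) R -> gt_pop_ps S P l r.

(* Main.v *)
Require Import Defs.
From mathcomp Require Import all_boot all_algebra.
From mathcomp Require Import zify.
From Stdlib Require Import Classical Permutation.

(** A value only dominates (up to equivalence) its proper subterms.  Hence, for
    a rule [l -> r] with root [f] of [l], every normal argument of a function
    call in [r] is either a subterm of a normal argument of [l] or is computed
    from such subterms by symbols below [f], and [r] contains at most one symbol
    equivalent to [f], whose normal arguments are strictly smaller in the
    multiset extension of the depth.  Since there are only polynomially many
    multisets of bounded size over [{0, ..., d}], a call of [f] unfolds into a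
    polynomially long chain of calls of symbols equivalent to [f], interleaved
    with boundedly many calls of smaller symbols per link.  By induction on the
    rank of [f] in the precedence, the number of steps is at most [p d] and the
    depth of every normal form reached is at most [q d + e], where [d] and [e]
    bound the depth of the normal and of the safe arguments, respectively. *)

Set Implicit Arguments.
Unset Strict Implicit.
Unset Printing Implicit Defensive.

(** * Polynomially bounded functions *)

(** The base [x.+1] is positive, so exponents can be enlarged even at [x = 0]. *)
Definition poly_bounded (f : nat -> nat) : Prop :=
  exists c k, forall x, f x <= c * x.+1 ^ k.

Lemma poly_bounded_cst c : poly_bounded (fun=> c).
Proof. by exists c, 0 => x; rewrite muln1. Qed.

Lemma poly_bounded_id : poly_bounded id.
Proof. by exists 1, 1 => x; rewrite expn1 mul1n. Qed.

Lemma poly_bounded_add f g :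
  poly_bounded f -> poly_bounded g -> poly_bounded (fun x => f x + g x).
Proof.
move=> [c [k fE]] [c' [k' gE]]; exists (c + c'), (k + k') => x.
rewrite mulnDl leq_add // ?(leq_trans (fE x)) ?(leq_trans (gE x)) //.
- by rewrite leq_mul2l leq_pexp2l ?orbT ?leq_addr.
- by rewrite leq_mul2l leq_pexp2l ?orbT ?leq_addl.
Qed.

Lemma poly_bounded_mul f g :
  poly_bounded f -> poly_bounded g -> poly_bounded (fun x => f x * g x).
Proof.
move=> [c [k fE]] [c' [k' gE]]; exists (c * c'), (k + k') => x.
by rewrite expnD mulnACA leq_mul.
Qed.

Lemma poly_bounded_exp f k :
  poly_bounded f -> poly_bounded (fun x => f x ^ k).
Proof.
move=> fP; elim: k => [|k IH]; first exact: (poly_bounded_cst 1).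
have [c [j E]] := poly_bounded_mul fP IH.
by exists c, j => x; rewrite expnS.
Qed.

Lemma poly_bounded_comp f g :
  poly_bounded f -> poly_bounded g -> poly_bounded (fun x => f (g x)).
Proof.
move=> [c [k fE]] gP.
have [a [j E]] : poly_bounded (fun x => c * (g x + 1) ^ k).
  apply/poly_bounded_mul/poly_bounded_exp/poly_bounded_add => //;
    exact: poly_bounded_cst.
exists a, j => x; apply: leq_trans (fE _) _.
by rewrite -addn1.
Qed.

Lemma poly_bounded_horner f :
  poly_bounded f -> exists p : {poly nat}, forall x, f x <= p.[x]%R.
Proof.
move=> [c [k fE]]; exists (c%:P * ('X + 1) ^+ k)%R => x.
apply: leq_trans (fE x) _.
by rewrite !hornerE -addn1 natrXE.
Qed.

(** * Ranks of multisets of bounded numbers *)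

(* The multiset extension of [<], as the lexicographic comparison of the
   multiplicities of [d, ..., 1]; [0] is not counted, so that it can be used for
   padding. *)
Definition mul_lt d (M N : seq nat) : bool :=
  [exists j : 'I_d.+1, [&& 0 < j, count_mem (j : nat) M < count_mem (j : nat) N
    & [forall i : 'I_d.+1,
         (j < i) ==> (count_mem (i : nat) M == count_mem (i : nat) N)]]].

Lemma mul_ltP d M N :
  reflect (exists j, [/\ 0 < j, j <= d, count_mem j M < count_mem j N
             & forall i, j < i -> i <= d -> count_mem i M = count_mem i N])
          (mul_lt d M N).
Proof.
apply: (iffP existsP) => [[j /and3P[j0 jlt /forallP jE]]|[j [j0 jd jlt jE]]].
  exists j; split=> // [|i ji id]; first by rewrite -ltnS.
  by move: (jE (Ordinal (id : i < d.+1))) => /implyP /(_ ji) /eqP.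
exists (Ordinal (jd : j < d.+1)); rewrite j0 jlt; apply/forallP => i.
by apply/implyP => ji; apply/eqP/jE => //; rewrite -ltnS.
Qed.

Lemma mul_lt_irr d M : ~~ mul_lt d M M.
Proof. by apply/mul_ltP => -[j []]; rewrite ltnn. Qed.

Lemma mul_lt_trans d : transitive (mul_lt d).
Proof.
move=> N M L /mul_ltP[j [j0 jd jlt jE]] /mul_ltP[k [k0 kd klt kE]].
apply/mul_ltP; case: (ltngtP j k) => [jk|kj|jk].
- exists k; split=> // [|i ki id]; first by rewrite jE.
  by rewrite jE ?kE // (ltn_trans jk).
- exists j; split=> // [|i ji id]; first by rewrite -kE.
  by rewrite jE ?kE // (ltn_trans kj).
- subst k; exists j; split=> // [|i ji id]; first exact: ltn_trans klt.
  by rewrite jE ?kE.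
Qed.

Lemma eq_mul_lt d M M' N N' :
  (forall j, 0 < j -> count_mem j M = count_mem j M') ->
  (forall j, 0 < j -> count_mem j N = count_mem j N') ->
  mul_lt d M N -> mul_lt d M' N'.
Proof.
move=> ME NE /mul_ltP[j [j0 jd jlt jE]]; apply/mul_ltP; exists j.
split=> // [|i ji id]; first by rewrite -ME // -NE.
have i0 : 0 < i by apply: leq_trans ji.
by rewrite -ME // -NE // jE.
Qed.

Lemma seq_max_mem (X : seq nat) :
  X <> [::] -> exists2 j, j \in X & forall x, x \in X -> x <= j.
Proof.
elim: X => // x [|y X] IH _.
  by exists x => [|z]; rewrite inE // => /eqP->.
have [//|j jX jmax] := IH; case: (leqP j x) => jx.
  exists x; first exact: mem_head.
  by move=> z; rewrite inE => /predU1P[->//|/jmax zj]; apply: leq_trans jx.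
exists j; first by rewrite inE jX orbT.
by move=> z; rewrite inE => /predU1P[->|/jmax//]; apply: ltnW.
Qed.

(** The maximum [j] of [X] decides: it is absent from [Y], nothing larger occurs in [X] or [Y], and
    [Z] contributes equally to both sides. *)
Lemma mul_lt_cat d (X Y Z : seq nat) :
  X <> [::] -> (forall x, x \in X -> 0 < x <= d) ->
  (forall y, y \in Y -> exists2 x, x \in X & y < x) ->
  mul_lt d (Y ++ Z) (X ++ Z).
Proof.
move=> X0 Xd YX; have [j jX jmax] := seq_max_mem X0.
have Ylt y : y \in Y -> y < j.
  by move=> /YX[x /jmax xj yx]; apply: leq_trans xj.
have /andP[j0 jd] := Xd j jX.
apply/mul_ltP; exists j; split=> // [|i ji _].
  rewrite !count_cat ltn_add2r.
  have /count_memPn-> : j \notin Y by apply/negP => /Ylt; rewrite ltnn.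
  by rewrite -has_count has_pred1.
rewrite !count_cat; congr (_ + _).
have /count_memPn-> : i \notin Y by apply/negP => /Ylt; rewrite ltnNge ltnW.
by have /count_memPn-> : i \notin X by apply/negP => /jmax; rewrite leqNgt ji.
Qed.

(** Tuples of length [K] represent, by padding with zeros, all multisets of at most [K] numbers up
    to [d]; counting the predecessors among them turns the order into a number. *)
Definition mul_rank K d (M : seq nat) : nat :=
  #|[set T : K.-tuple 'I_d.+1 | mul_lt d [seq val i | i <- T] M]|.

Lemma mul_rank_le K d M : mul_rank K d M <= d.+1 ^ K.
Proof. by apply: leq_trans (max_card _) _; rewrite card_tuple card_ord. Qed.

(** Transitivity gives the inclusion of the sets of predecessors. It is strict because [M], padded
    to a [K]-tuple, lies below [N] but not below itself. *)
Lemma mul_rank_lt K d M N :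
  size M <= K -> (forall x, x \in M -> x <= d) -> mul_lt d M N ->
  mul_rank K d M < mul_rank K d N.
Proof.
move=> MK Md MN; apply/proper_card/properP; split.
  by apply/subsetP => T; rewrite !inE => TM; apply: mul_lt_trans MN.
pose s := M ++ nseq (K - size M) 0.
have sK : size [seq inord i : 'I_d.+1 | i <- s] == K.
  by rewrite size_map size_cat size_nseq subnKC.
have sE : [seq val i | i <- Tuple sK] = s.
  rewrite -map_comp map_id_in // => x.
  rewrite mem_cat mem_nseq => /orP[/Md xd|/andP[_ /eqP->]] /=;
  by rewrite inordK.
have cE j : 0 < j -> count_mem j M = count_mem j s.
  by rewrite count_cat count_nseq => /prednK <-; rewrite addn0.
exists (Tuple sK); rewrite inE sE; first exact: eq_mul_lt MN.
apply: contra (mul_lt_irr d M); apply: eq_mul_lt => // j j0.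
by rewrite cE.
Qed.

(** * Auxiliary facts on lists and sums *)

Lemma count_Permutation (T : Type) (p : pred T) s t :
  Permutation s t -> count p s = count p t.
Proof.
elim=> //= [x {}s {}t _ ->|x y {}s|s1 s2 s3 _ -> _ ->] //.
by rewrite addnCA.
Qed.

Lemma mem_map_In (T : Type) (h : T -> nat) s y :
  y \in map h s -> exists2 x, List.In x s & h x = y.
Proof.
elim: s => //= x s IH; rewrite inE => /predU1P[->|/IH[z zs <-]].
  by exists x; first left.
by exists z; first right.
Qed.

Lemma In_mem_map (T : Type) (h : T -> nat) s x :
  List.In x s -> h x \in map h s.
Proof.
by elim: s => //= y s IH [->|/IH]; rewrite inE ?eqxx // => ->; rewrite orbT.
Qed.

Lemma Forall2_In (T : Type) (e : T -> T -> Prop) s t y :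
  List.Forall2 e s t -> List.In y t -> exists2 x, List.In x s & e x y.
Proof.
elim=> //= x z {}s {}t xz _ IH [<-|/IH[w ws wy]]; first by exists x; first left.
by exists w; first right.
Qed.

Lemma In_map (I : eqType) (T : Type) (h : I -> T) s x :
  List.In x [seq h i | i <- s] -> exists2 i, i \in s & x = h i.
Proof.
elim: s => //= i s IH [<-|/IH[j js ->]]; first by exists i; rewrite ?mem_head.
by exists j; rewrite // inE js orbT.
Qed.

Lemma map_In (I : eqType) (T : Type) (h : I -> T) s i :
  i \in s -> List.In (h i) [seq h i | i <- s].
Proof.
elim: s => //= j s IH; rewrite inE => /predU1P[->|/IH]; [by left|by right].
Qed.

Lemma sum_at_most_one (I : finType) (p : pred I) m :
  (forall i j, p i -> p j -> i = j) -> \sum_i (if p i then m else 0) <= m.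
Proof.
move=> pE; rewrite -big_mkcond.
case: (pickP p) => [i pi|p0]; last by rewrite big_pred0.
rewrite (big_pred1 i) // => j /=; apply/idP/eqP => [pj|->//]; exact: pE.
Qed.

(** * Terms, normal forms and innermost steps *)

Section Rewriting.
Variables (F : signature) (R : trs F).
Implicit Types (t u v : term F) (f g : F).

Lemma term_ffun_ind (Q : term F -> Prop) :
  (forall x, Q (Var x)) ->
  (forall f (ts : {ffun 'I_(arity f) -> term F}),
     (forall i, Q (ts i)) -> Q (App f ts)) ->
  forall t, Q t.
Proof.
move=> QV QA; fix IH 1; case=> [x|f ts]; first exact: QV.
by apply: QA => i; apply: IH.
Qed.

Lemma depth_gt0 t : 0 < depth t.
Proof. by case: t. Qed.

Lemma depth_arg f (ts : {ffun 'I_(arity f) -> term F}) i :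
  depth (ts i) < depth (App f ts).
Proof. by rewrite /= add1n ltnS; apply: (bigmax_sup i). Qed.

Lemma depth_App_le f (ts : {ffun 'I_(arity f) -> term F}) d :
  (forall i, depth (ts i) <= d) -> depth (App f ts) <= d.+1.
Proof. by move=> H; rewrite /= add1n ltnS; apply/bigmax_leqP. Qed.

Lemma value_Fun t f : value t -> f \in Fun t -> f \notin defined F.
Proof.
elim/term_ffun_ind: t => [x|g ts IH] /=; first by rewrite inE.
move=> /andP[gC /forallP tsV]; rewrite in_setU1 => /predU1P[->//|].
by move=> /bigcupP[i _]; apply: IH.
Qed.

Lemma normal_form_arg f (ts : {ffun 'I_(arity f) -> term F}) i :
  normal_form R (App f ts) -> normal_form R (ts i).
Proof. by move=> nf u /(@rewrite_arg F R f ts i) /nf. Qed.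

Lemma innermost_rewrite t u : innermost_step R t u -> rewrite_step R t u.
Proof.
elim=> [f ls r sigma lr _|f ts i {}u _ IH]; first exact: rewrite_root.
exact: rewrite_arg.
Qed.

Lemma innermost_stepP t u :
  innermost_step R t u ->
  match t with
  | Var _ => False
  | App f ts =>
    (exists i v, innermost_step R (ts i) v /\ u = App f (replace_arg ts i v)) \/
    (exists ls r sigma,
       [/\ List.In (App f ls, r) R, forall i, ts i = subst sigma (ls i),
           forall i, normal_form R (ts i) & u = subst sigma r])
  end.
Proof.
case=> {t u} [f ls r sigma lr nf|f ts i v iv] /=; last by left; exists i, v.
by right; exists ls, r, sigma; split=> // i; rewrite ffunE; last exact: nf.
Qed.

(** Only the depth of reachable normal forms is controlled, since these are what an enclosing call
    receives; intermediate terms may be deeper. *)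
Definition bounded t N D : Prop :=
  forall n u, innermost_steps R n t u ->
    n <= N /\ (normal_form R u -> depth u <= D).

Lemma bounded_le t N D N' D' :
  N <= N' -> D <= D' -> bounded t N D -> bounded t N' D'.
Proof.
move=> NN DD tb n u /tb[nN uD].
by split=> [|/uD uD']; [apply: leq_trans nN NN|apply: leq_trans uD' DD].
Qed.

Lemma bounded_depth t N D : bounded t N D -> normal_form R t -> depth t <= D.
Proof. by move=> /(_ 0 t (innermost_steps0 _ _))[]. Qed.

Lemma bounded_step t u N D :
  bounded t N D -> innermost_step R t u -> 0 < N /\ bounded u N.-1 D.
Proof.
move=> tb tu; split.
  case: (tb 1 u) => //.
  by apply: innermost_stepsS tu _; apply: innermost_steps0.
move=> n v uv; case: (tb n.+1 v); first exact: innermost_stepsS tu uv.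
by move=> nN vD; split=> //; case: N nN {tb}.
Qed.

Lemma normal_form_bounded t N D :
  normal_form R t -> depth t <= D -> bounded t N D.
Proof.
move=> nf tD n u tu; case: tu nf tD => {n t u} [t|n t u v tu _] nf tD //.
by case: (nf u); apply: innermost_rewrite.
Qed.

(** A step in argument [i] is paid for by [N i]; a root step needs all arguments normal, so it and
    all later steps are covered by [N']. The last premise on [ws] records that arguments already
    normal do not change, so comparisons between them survive. *)
Lemma bounded_App f (ts : {ffun 'I_(arity f) -> term F}) N D N' D' :
  (forall i, bounded (ts i) (N i) (D i)) ->
  (forall ws : {ffun 'I_(arity f) -> term F},
     (forall i, normal_form R (ws i)) -> (forall i, depth (ws i) <= D i) ->
     (forall i, normal_form R (ts i) -> ws i = ts i) ->
     bounded (App f ws) N' D') ->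
  bounded (App f ts) (\sum_i N i + N') D'.
Proof.
move=> tsb wsb n; elim: n ts N tsb wsb => [|n IH] ts N tsb wsb u tu.
  split=> // nf; have {tu}uE : u = App f ts by inversion tu.
  rewrite uE in nf *; have nfa i := normal_form_arg (i := i) nf.
  apply: (@bounded_depth _ N' _ _ nf); apply: wsb => // i.
  exact: bounded_depth (tsb i) (nfa i).
inversion tu as [|n' t' v u' tv vu]; subst.
have [[i [w [iw vE]]]|[ls [r [sigma [lr tsE nf vE]]]]] := innermost_stepP tv.
  have [Ni wb] := bounded_step (tsb i) iw.
  rewrite vE in vu.
  pose N1 j := if j == i then (N i).-1 else N j.
  have N1E : \sum_j N j = (\sum_j N1 j).+1.
    rewrite (bigD1 i) // [in RHS](bigD1 i) //= /N1 eqxx.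
    rewrite -addSn prednK //; congr (_ + _).
    by apply: eq_bigr => j /negPf->.
  have [||nN uD] := IH (replace_arg ts i w) N1 _ _ u vu.
  - by move=> j; rewrite ffunE /N1; case: eqP => [->|].
  - move=> ws wsnf wsD wsE; apply: wsb => // j jnf.
    have ji : j != i.
      apply/eqP => ji; rewrite ji in jnf.
      by apply: (jnf w); apply: innermost_rewrite.
    by have := wsE j; rewrite ffunE (negPf ji); apply.
  - by split=> //; rewrite N1E addSn ltnS.
have [|//|nN uD] := wsb ts nf _ _ n.+1 u tu.
  by move=> i; apply: bounded_depth (tsb i) (nf i).
by split=> //; apply: leq_trans nN (leq_addl _ _).
Qed.

Hypothesis RC : constructor_trs R.

Lemma normal_form_constructor f (ts : {ffun 'I_(arity f) -> term F}) :
  f \notin defined F -> (forall i, normal_form R (ts i)) ->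
  normal_form R (App f ts).
Proof.
(* [inv] holds of the source of every step, which allows generalizing [App f ts] before the case
   analysis. *)
pose inv t := match t with
  | Var _ => True
  | App f ts => f \in defined F \/ exists i, ~ normal_form R (ts i)
  end.
move=> fC nf u fu; suff: inv (App f ts).
  by case=> [|[i /(_ (nf i))]] //; rewrite (negPf fC).
move: (App f ts) u fu => _ _ [l r sigma lr|g ss i u iu].
  by have := RC lr; case: l {lr} => //= g ss /andP[gD _]; left.
by right; exists i => /(_ u iu).
Qed.

Lemma normal_form_Var x : normal_form R (Var x).
Proof.
pose is_app t := if t is App _ _ then true else false.
move=> u xu; suff: is_app (Var x) by [].
move: (Var x) u xu => _ _ [l r sigma lr|g ss i u iu] //.
by have := RC lr; case: l {lr}.
Qed.

Lemma value_normal_form t : value t -> normal_form R t.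
Proof.
elim/term_ffun_ind: t => [x|f ts IH]; first by move=> _; apply: normal_form_Var.
move=> /= /andP[fC /forallP tsV].
by apply: normal_form_constructor => // i; apply: IH.
Qed.

End Rewriting.

(** * Bounds on derivations along the path order *)

(* Bounds, in terms of the maximal depth [d] of the normal arguments of a
   redex, on the evaluation of a right-hand side of depth at most [h] whose
   calls [g(u; v)] take at most [p (depth u)] steps and increase the depth of
   [v] by at most [q (depth u)]. *)
Fixpoint depth_bound (q : nat -> nat) h d :=
  if h is h'.+1 then q (depth_bound q h' d) + depth_bound q h' d else d.

Fixpoint step_bound K (p q : nat -> nat) h d :=
  if h is h'.+1 then K * step_bound K p q h' d + p (depth_bound q h' d) else 0.

(** Here [n] strictly exceeds the rank of the called symbol, and [(d.+1 ^ K).+1], one more than the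
    bound on multiset ranks, limits the chain of equivalent calls. Adding the previous level covers
    the smaller ranks too. *)
Fixpoint call_depth K H n : nat -> nat :=
  if n is n'.+1 then fun d => call_depth K H n' d +
    (d.+1 + (d.+1 ^ K).+1 * depth_bound (call_depth K H n') H d)
  else fun=> 0.

Fixpoint call_steps K H n : nat -> nat :=
  if n is n'.+1 then fun d => call_steps K H n' d +
    (d.+1 ^ K).+1 *
      (step_bound K (call_steps K H n') (call_depth K H n') H d).+1
  else fun=> 0.

Lemma poly_bounded_succ f : poly_bounded f -> poly_bounded (fun x => (f x).+1).
Proof. exact: (poly_bounded_add (poly_bounded_cst 1)). Qed.

Lemma poly_bounded_depth_bound q h :
  poly_bounded q -> poly_bounded (depth_bound q h).
Proof.
move=> qP; elim: h => [|h IH] /=; first exact: poly_bounded_id.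
by apply: poly_bounded_add => //; apply: poly_bounded_comp qP IH.
Qed.

Lemma poly_bounded_step_bound K p q h :
  poly_bounded p -> poly_bounded q -> poly_bounded (step_bound K p q h).
Proof.
move=> pP qP; elim: h => [|h IH] /=; first exact: poly_bounded_cst.
apply: poly_bounded_add; first exact/poly_bounded_mul/IH/poly_bounded_cst.
by apply: poly_bounded_comp pP _; apply: poly_bounded_depth_bound.
Qed.

Lemma poly_bounded_succ_exp K : poly_bounded (fun d => (d.+1 ^ K).+1).
Proof.
exact/poly_bounded_succ/poly_bounded_exp/poly_bounded_succ/poly_bounded_id.
Qed.

Lemma poly_bounded_call_depth K H n : poly_bounded (call_depth K H n).
Proof.
elim: n => [|n IH] /=; first exact: poly_bounded_cst.
apply: poly_bounded_add => //; apply: poly_bounded_add.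
  exact/poly_bounded_succ/poly_bounded_id.
apply: poly_bounded_mul; first exact: poly_bounded_succ_exp.
exact: poly_bounded_depth_bound.
Qed.

Lemma poly_bounded_call_steps K H n : poly_bounded (call_steps K H n).
Proof.
elim: n => [|n IH] /=; first exact: poly_bounded_cst.
apply: poly_bounded_add => //; apply: poly_bounded_mul.
  exact: poly_bounded_succ_exp.
by apply/poly_bounded_succ/poly_bounded_step_bound/poly_bounded_call_depth.
Qed.

Lemma depth_bound_ge q h d : d <= depth_bound q h d.
Proof. by elim: h => //= h /leq_trans; apply; apply: leq_addl. Qed.

(** * Values under the path order *)

Section PathOrder.
Variables (F : signature) (R : trs F) (S : safe_mapping F) (P : precedence F).
Hypotheses (RC : constructor_trs R) (Padm : admissible P).
Hypothesis PC : constructors_not_above_defined P.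
Implicit Types (s t u : term F) (f g : F) (sigma : nat -> term F).

Lemma gt_pop_psP s t :
  gt_pop_ps S P s t ->
  match s with
  | Var _ => False
  | App f ss =>
    (exists i, gt_pop_ps S P (ss i) t \/ safe_equiv S P (ss i) t) \/
    f \in defined F /\ exists g (ts : {ffun 'I_(arity g) -> term F}),
    [/\ t = App g ts,
        forall j, j \in safe S g -> gt_pop_ps S P (App f ss) (ts j) &
        [/\ prec_gt P f g,
            forall j, j \notin safe S g -> gt_sq S P (App f ss) (ts j) &
            forall j1 j2, j1 \in safe S g -> j2 \in safe S g ->
              ~~ term_over (below P (Fun (App f ss))) (ts j1) ->
              ~~ term_over (below P (Fun (App f ss))) (ts j2) -> j1 = j2] \/
        [/\ prec_eq P f g,
            multiset_gt (safe_equiv S P) (gt_pop_ps S P)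
              (normal_args S ss) (normal_args S ts) &
            forall j, j \in safe S g ->
              term_over (below P (Fun (App f ss))) (ts j)]]
  end.
Proof.
case=> {s t} [f ss t i it|f ss g ts fD fg sq pop one|
  f ss g ts fD fg mul pop ov].
- by left; exists i.
- by right; split=> //; exists g, ts; split=> //; left.
- by right; split=> //; exists g, ts; split=> //; right.
Qed.

Lemma gt_sqP s t :
  gt_sq S P s t ->
  match s with
  | Var _ => False
  | App f ss =>
    (exists2 i, f \in defined F -> i \notin safe S f &
       gt_sq S P (ss i) t \/ safe_equiv S P (ss i) t) \/
    f \in defined F /\ exists g (ts : {ffun 'I_(arity g) -> term F}),
      [/\ t = App g ts, prec_gt P f g & forall j, gt_sq S P (App f ss) (ts j)]
  end.
Proof.
case=> {s t} [f ss t i fi it|f ss g ts fD fg sq]; first by left; exists i.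
by right; split=> //; exists g, ts.
Qed.

Lemma gt_sq_value s t : value s -> gt_sq S P s t -> gt_pop_ps S P s t.
Proof.
elim/term_ffun_ind: s => [x _ xt|f ss IH /= /andP[fC /forallP ssV]].
  by inversion xt.
move=> /gt_sqP[[i _ [/(IH _ (ssV i)) it|it]]|[fD _]].
- by apply: (gt_pop_ps_arg (i := i)); left.
- by apply: (gt_pop_ps_arg (i := i)); right.
- by rewrite fD in fC.
Qed.

(** By admissibility a symbol equivalent to a constructor is a constructor, and permuting arguments
    preserves the maximum of their depths. *)
Lemma safe_equiv_value sigma s t :
  safe_equiv S P s t -> value s -> normal_form R (subst sigma s) ->
  normal_form R (subst sigma t) /\
  depth (subst sigma t) = depth (subst sigma s).
Proof.
elim=> {s t} // f g ss ts pi fg pib _ _ IH /= /andP[fC /forallP ssV] nf.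
have [pi' piK pi'K] := pib.
have E i : normal_form R (subst sigma (ts (pi i))) /\
    depth (subst sigma (ts (pi i))) = depth (subst sigma (ss i)).
  apply: IH => //; by have := normal_form_arg (i := i) nf; rewrite ffunE.
split.
  apply: normal_form_constructor; rewrite -?(Padm fg) // => j.
  by rewrite ffunE -(pi'K j); case: (E (pi' j)).
congr (_ + _); rewrite (reindex pi) /=; last exact: onW_bij.
by apply: eq_bigr => i _; rewrite !ffunE; case: (E i).
Qed.

(** The root of a value is a constructor, so only the subterm clause applies and the depth drops. *)
Lemma gt_pop_ps_value sigma s t :
  gt_pop_ps S P s t -> value s -> normal_form R (subst sigma s) ->
  normal_form R (subst sigma t) /\
  depth (subst sigma t) < depth (subst sigma s).
Proof.
elim/term_ffun_ind: s => [x xt|f ss IH]; first by inversion xt.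
move=> /gt_pop_psP[[i it]|[fD _]] /= /andP[fC /forallP ssV] nf; last first.
  by rewrite fD in fC.
have := normal_form_arg (i := i) nf; rewrite ffunE => nfi.
suff [nft le] : normal_form R (subst sigma t) /\
    depth (subst sigma t) <= depth (subst sigma (ss i)).
  split=> //; apply: leq_ltn_trans le _.
  by have := depth_arg [ffun i => subst sigma (ss i)] i; rewrite ffunE.
case: it => it; first by have [? /ltnW] := IH i it (ssV i) nfi.
by have [? ->] := safe_equiv_value it (ssV i) nfi.
Qed.

Lemma gt_pop_ps_value_eq sigma s t :
  gt_pop_ps S P s t \/ safe_equiv S P s t ->
  value s -> normal_form R (subst sigma s) ->
  normal_form R (subst sigma t) /\
  depth (subst sigma t) <= depth (subst sigma s).
Proof.
move=> [st|st] sV nf; first by have [? /ltnW] := gt_pop_ps_value st sV nf.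
by have [? ->] := safe_equiv_value st sV nf.
Qed.

(** Neither [f], being equivalent to [g], nor a constructor of [ls], by [PC], lies strictly above
    [g]. Hence terms over the symbols below the left-hand side contain no recursive call. *)
Lemma term_over_below f (ls : {ffun 'I_(arity f) -> term F})
    g (ts : {ffun 'I_(arity g) -> term F}) :
  basic (App f ls) -> prec_eq P f g ->
  ~~ term_over (below P (Fun (App f ls))) (App g ts).
Proof.
move=> /= /andP[fD /forallP lsV] fg; apply/negP => /andP[+ _].
rewrite inE => /existsP[h /andP[+ hg]].
rewrite in_setU1 => /predU1P[hf|/bigcupP[i _ /(value_Fun (lsV i)) hC]].
  by move: fg hg; rewrite hf /prec_eq /prec_gt => /andP[_ ->]; rewrite andbF.
by move: (PC hC (f := g)); rewrite -(Padm fg) fD hg => /(_ isT).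
Qed.

(** * Ranks of symbols and depths of normal arguments *)

Definition rank f := #|[set g | prec_gt P f g]|.

Lemma rank_lt f g : prec_gt P f g -> rank g < rank f.
Proof.
move=> fg; have /andP[fgE gfE] := fg; apply/proper_card/properP; split.
  apply/subsetP => h; rewrite !inE => /andP[gh hg].
  rewrite /prec_gt (prec_trans fgE gh) /=.
  by apply: contra gfE => hf; apply: prec_trans gh hf.
by exists g; rewrite !inE // /prec_gt prec_refl.
Qed.

Lemma rank_eq f g : prec_eq P f g -> rank f = rank g.
Proof.
move=> /andP[fg gf]; apply: eq_card => h; rewrite !inE /prec_gt.
congr (_ && ~~ _); apply/idP/idP => H.
- exact: prec_trans gf H.
- exact: prec_trans fg H.
- exact: prec_trans H fg.
- exact: prec_trans H gf.
Qed.

Definition normal_depths f (ts : {ffun 'I_(arity f) -> term F}) :=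
  [seq depth t | t <- normal_args S ts].

Lemma normal_depths_subst sigma f (ts : {ffun 'I_(arity f) -> term F}) :
  normal_depths [ffun i => subst sigma (ts i)] =
  [seq depth (subst sigma t) | t <- normal_args S ts].
Proof.
by rewrite /normal_depths /normal_args -!map_comp; apply: eq_map => i /=;
  rewrite ffunE.
Qed.

Lemma multiset_gt_value sigma f (ss : {ffun 'I_(arity f) -> term F})
    g (ts : {ffun 'I_(arity g) -> term F}) d :
  multiset_gt (safe_equiv S P) (gt_pop_ps S P)
    (normal_args S ss) (normal_args S ts) ->
  (forall i, i \notin safe S f ->
     [/\ value (ss i), normal_form R (subst sigma (ss i)) &
         depth (subst sigma (ss i)) <= d]) ->
  (forall j, j \notin safe S g -> normal_form R (subst sigma (ts j)) /\
     depth (subst sigma (ts j)) <= d) /\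
  mul_lt d (normal_depths [ffun j => subst sigma (ts j)])
    (normal_depths [ffun i => subst sigma (ss i)]).
Proof.
move=> [X [Y [Z [Z' [MX NY ZZ X0 YX]]]]] ssP.
have MP s : List.In s (X ++ Z) ->
    [/\ value s, normal_form R (subst sigma s) & depth (subst sigma s) <= d].
  move=> /(Permutation_in s (Permutation_sym MX)) sM.
  have [i] := In_map sM; by rewrite mem_enum inE => iN ->; apply: ssP.
have XP s (sX : List.In s X) := MP s (List.in_or_app _ _ _ (or_introl sX)).
have ZP s (sZ : List.In s Z) := MP s (List.in_or_app _ _ _ (or_intror sZ)).
split=> [j jN|].
  have : List.In (ts j) (normal_args S ts).
    by apply: (map_In ts); rewrite mem_enum inE.
  move=> /(Permutation_in (ts j) NY) jN'.
  case: (List.in_app_or _ _ _ jN') => [/YX[x xX xj]|].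
    have [xV xnf xd] := XP x xX.
    have [nf lt] := gt_pop_ps_value xj xV xnf.
    by split=> //; apply: leq_trans (ltnW lt) xd.
  move=> /(Forall2_In ZZ)[z zZ zj]; have [zV znf zd] := ZP z zZ.
  by have [nf ->] := safe_equiv_value zj zV znf.
rewrite !normal_depths_subst; set D := fun t => depth (subst sigma t).
(* Equivalent values have equal depths, so the parts matched by equivalence cancel. *)
have DZ : map D Z' = map D Z.
  elim: ZZ ZP => //= z z' Z1 Z1' zz _ IH ZP.
  have [|zV znf _] := ZP z; first by left.
  rewrite IH; last by move=> s sZ; apply: ZP; right.
  by congr (_ :: _); case: (safe_equiv_value zz zV znf).
have lt : mul_lt d (map D Y ++ map D Z) (map D X ++ map D Z).
  apply: mul_lt_cat; first by case: X X0 {MX YX MP XP}.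
    move=> _ /mem_map_In[x /XP[_ _ xd] <-].
    by rewrite depth_gt0.
  move=> _ /mem_map_In[y /YX[x xX xy] <-].
  have [xV xnf _] := XP x xX.
  exists (D x); first exact: In_mem_map.
  by case: (gt_pop_ps_value xy xV xnf).
apply: eq_mul_lt lt => j _.
  by rewrite -DZ -map_cat; symmetry; apply/count_Permutation/Permutation_map.
by rewrite -map_cat; symmetry; apply/count_Permutation/Permutation_map.
Qed.

(** The safe depth [e] enters additively and only in the depth bound, so nesting calls through safe
    positions adds bounds instead of composing them. *)
Definition call_bounded (p q : nat -> nat) g : Prop :=
  forall (ws : {ffun 'I_(arity g) -> term F}) d e,
    (forall i, normal_form R (ws i)) ->
    (forall i, i \notin safe S g -> depth (ws i) <= d) ->
    (forall i, i \in safe S g -> depth (ws i) <= e) ->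
    bounded R (App g ws) (p d) (q d + e).

Variable K : nat.
Hypothesis arityK : forall f, arity f <= K.

(** * Evaluation of an instantiated right-hand side *)

Section Rule.
Variables (f : F) (ls : {ffun 'I_(arity f) -> term F}) (sigma : nat -> term F).
Variables (d e : nat) (p q : nat -> nat).
Hypothesis lB : basic (App f ls).
Hypothesis lsnf : forall i, normal_form R (subst sigma (ls i)).
Hypothesis lsd : forall i, i \notin safe S f -> depth (subst sigma (ls i)) <= d.
Hypothesis lse : forall i, i \in safe S f -> depth (subst sigma (ls i)) <= e.
Hypothesis low : forall g, prec_gt P f g -> call_bounded p q g.

Let lsV i : value (ls i).
Proof. by have /andP[_ /forallP] := lB. Qed.

Let fD : f \in defined F.
Proof. by have /andP[] := lB. Qed.

(** Below a defined root, [gt_sq] reaches only normal arguments, so the bounds are free of [e]. *)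
Lemma gt_sq_bounded t h :
  depth t <= h -> gt_sq S P (App f ls) t ->
  bounded R (subst sigma t) (step_bound K p q h d) (depth_bound q h d).
Proof.
elim: h t => [|h IH] t th; first by have := depth_gt0 t; rewrite ltnNge th.
move=> /gt_sqP[[i /(_ fD) iN it]|[_ [g [ts [tE fg sq]]]]].
  have [nf le] : normal_form R (subst sigma t) /\
      depth (subst sigma t) <= depth (subst sigma (ls i)).
    apply: gt_pop_ps_value_eq => //.
    by case: it => [/(gt_sq_value (lsV i))|]; [left|right].
  apply: normal_form_bounded => //; apply: leq_trans (depth_bound_ge _ _ _).
  by apply: leq_trans le _; apply: lsd.
rewrite {}tE in th *; set A := step_bound K p q h d; set B := depth_bound q h d.
apply: (@bounded_le _ _ _ (\sum_(i < arity g) A + p B) (q B + B)) => //.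
  by rewrite sum_nat_const card_ord leq_add2r leq_mul2r arityK orbT.
apply: (bounded_App (D := fun=> B)) => [i|ws wsnf wsB _].
  rewrite ffunE; apply: IH => //.
  by rewrite -ltnS; apply: leq_trans th; apply: depth_arg.
by apply: low.
Qed.

Lemma gt_pop_ps_arg_bounded i t N D :
  gt_pop_ps S P (ls i) t \/ safe_equiv S P (ls i) t -> d + e <= D ->
  bounded R (subst sigma t) N D.
Proof.
move=> it deD; have [nf le] := gt_pop_ps_value_eq it (lsV i) (@lsnf i).
apply: normal_form_bounded => //; apply: leq_trans le _.
apply: leq_trans deD; case: (boolP (i \in safe S f)) => iS.
  by apply: leq_trans (lse iS) (leq_addl _ _).
by apply: leq_trans (lsd iS) (leq_addr _ _).
Qed.

(** By [term_over_below] no symbol equivalent to [f] occurs in [t], so [low] covers all calls, and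
    [q] is only applied to depths independent of [e]. *)
Lemma gt_pop_ps_below_bounded t h :
  depth t <= h -> gt_pop_ps S P (App f ls) t ->
  term_over (below P (Fun (App f ls))) t ->
  bounded R (subst sigma t) (step_bound K p q h d) (depth_bound q h d + e).
Proof.
elim: h t => [|h IH] t th; first by have := depth_gt0 t; rewrite ltnNge th.
move=> /gt_pop_psP[[i it] _|[_ [g [ts [tE pop cases]]]] tov].
  by apply: gt_pop_ps_arg_bounded it _; rewrite leq_add2r depth_bound_ge.
rewrite {}tE in th tov *; case: cases => [[fg sq _]|[fg _ _]]; last first.
  by move: tov; rewrite (negPf (term_over_below ts lB fg)).
have tsh i : depth (ts i) <= h.
  by rewrite -ltnS; apply: leq_trans th; apply: depth_arg.
have /andP[_ /forallP tsov] := tov.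
set A := step_bound K p q h d; set B := depth_bound q h d.
apply: (@bounded_le _ _ _ (\sum_(i < arity g) A + p B) (q B + (B + e))).
- by rewrite sum_nat_const card_ord leq_add2r leq_mul2r arityK orbT.
- by rewrite addnA.
apply: (bounded_App (D := fun i => if i \in safe S g then B + e else B)).
  move=> i; rewrite ffunE; case: ifP => iS.
    by apply: IH => //; apply: pop.
  by apply: gt_sq_bounded => //; apply: sq; rewrite iS.
move=> ws wsnf wsB _; apply: low => // i iS; have := wsB i.
  by rewrite (negPf iS).
by rewrite iS.
Qed.

Variables (M E : nat).
(** This is the induction hypothesis along the chain; [e'] is free because the evaluated safe
    arguments of the recursive call may be deeper than [e]. *)
Hypothesis rec : forall g (ws : {ffun 'I_(arity g) -> term F}) e',
  prec_eq P f g -> (forall i, normal_form R (ws i)) ->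
  (forall i, i \notin safe S g -> depth (ws i) <= d) ->
  (forall i, i \in safe S g -> depth (ws i) <= e') ->
  mul_lt d (normal_depths ws) (normal_depths [ffun i => subst sigma (ls i)]) ->
  bounded R (App g ws) M (E + e').

(** At each level at most one safe argument may contain a recursive call, and the safe arguments of
    such a call contain none, so [M] and [E] are charged once and not multiplied by the arity. *)
Lemma gt_pop_ps_bounded t h :
  depth t <= h -> gt_pop_ps S P (App f ls) t ->
  bounded R (subst sigma t) (step_bound K p q h d + M)
    (depth_bound q h d + E + e).
Proof.
elim: h t => [|h IH] t th; first by have := depth_gt0 t; rewrite ltnNge th.
move=> /gt_pop_psP[[i it]|[_ [g [ts [tE pop cases]]]]].
  apply: gt_pop_ps_arg_bounded it _.
  by rewrite -addnA leq_add ?depth_bound_ge ?leq_addl.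
rewrite {}tE in th *.
have tsh i : depth (ts i) <= h.
  by rewrite -ltnS; apply: leq_trans th; apply: depth_arg.
rewrite /=; set A := step_bound K p q h d; set B := depth_bound q h d.
have gA : \sum_(i < arity g) A <= K * A.
  by rewrite sum_nat_const card_ord leq_mul2r arityK orbT.
case: cases => [[fg sq one]|[fg mul ov]].
  pose top i := (i \in safe S g) &&
    ~~ term_over (below P (Fun (App f ls))) (ts i).
  have topM : \sum_i (if top i then M else 0) <= M.
    apply: sum_at_most_one => i j /andP[iS iov] /andP[jS jov]; exact: one.
  apply: (@bounded_le _ _ _
    (\sum_i (A + if top i then M else 0) + p B) (q B + (B + E + e))).
  - by rewrite big_split /= addnAC leq_add // leq_add2r.
  - by lia.
  apply: (bounded_App (D := fun i => if i \in safe S g then B + E + e else B)).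
    move=> i; rewrite ffunE /top; case: (boolP (i \in safe S g)) => iS /=.
      case: ifP => iov; first by apply: IH => //; apply: pop.
      apply: (@bounded_le _ _ _ A (B + e)); [lia|lia|].
      apply: gt_pop_ps_below_bounded => //; first exact: pop.
      by move: iov => /negbFE.
    by rewrite addn0; apply: gt_sq_bounded => //; apply: sq.
  move=> ws wsnf wsB _; apply: low => // i iS; have := wsB i.
    by rewrite (negPf iS).
  by rewrite iS.
have [tsP lt] := multiset_gt_value (sigma := sigma) (d := d) mul
  (fun i iN => And3 (lsV i) (@lsnf i) (lsd iN)).
apply: (@bounded_le _ _ _ (\sum_(i < arity g) A + M) (E + (B + e))).
- by rewrite leq_add2r (leq_trans gA) ?leq_addr.
- by lia.
apply: (bounded_App (D := fun i => if i \in safe S g then B + e else d)).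
  move=> i; rewrite ffunE; case: ifP => iS.
    by apply: gt_pop_ps_below_bounded => //; [apply: pop|apply: ov].
  by have [nf le] := tsP i (negbT iS); apply: normal_form_bounded.
(* The normal arguments of the recursive call are already normal forms, so they reach it unchanged
   and [lt] applies to [ws]. *)
move=> ws wsnf wsB wsE.
have nE i : i \notin safe S g -> ws i = subst sigma (ts i).
  by move=> iN; rewrite wsE ffunE //; case: (tsP i iN).
apply: rec => // [i iN|i iS|].
- by have := wsB i; rewrite (negPf iN).
- by have := wsB i; rewrite iS.
- suff -> : normal_depths ws = normal_depths [ffun j => subst sigma (ts j)].
    by [].
  rewrite normal_depths_subst /normal_depths /normal_args -!map_comp.
  by apply/eq_in_map => i; rewrite mem_enum inE => /nE /= ->.
Qed.

End Rule.

(** * Chains of equivalent calls and induction on the rank *)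

Variable H : nat.
Hypothesis depthH : forall l r, List.In (l, r) R -> depth r <= H.
Hypothesis Rpop : forall l r, List.In (l, r) R -> gt_pop_ps S P l r.

(** Here [m] bounds the length of the chain: a root step leaves at most one call of an equivalent
    symbol, whose multiset rank is smaller. *)
Lemma chain_bounded n p q d m f (ws : {ffun 'I_(arity f) -> term F}) e :
  (forall g, rank g < n -> call_bounded p q g) ->
  rank f = n -> (forall i, normal_form R (ws i)) ->
  (forall i, i \notin safe S f -> depth (ws i) <= d) ->
  (forall i, i \in safe S f -> depth (ws i) <= e) ->
  mul_rank K d (normal_depths ws) < m ->
  bounded R (App f ws) (m * (step_bound K p q H d).+1)
    (d.+1 + m * depth_bound q H d + e).
Proof.
move=> low; elim: m f ws e => // m IH f ws e fn wsnf wsd wse wsm k u ku.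
inversion ku as [|k' t' v u' tv vu]; subst.
  (* With no step the term itself may be the normal form, one deeper than its arguments; hence the
     summand [d.+1]. *)
  split=> // _; apply: leq_trans (depth_App_le (d := d + e) _) _; last by lia.
  move=> i; case: (boolP (i \in safe S f)) => iS.
    by apply: leq_trans (wse i iS) (leq_addl _ _).
  by apply: leq_trans (wsd i iS) (leq_addr _ _).
have [[i [w [iw _]]]|[ls [r [sigma [lr wsE _ vE]]]]] := innermost_stepP tv.
  by case: (wsnf i w); apply: innermost_rewrite.
have wsE' : ws = [ffun i => subst sigma (ls i)].
  by apply/ffunP => i; rewrite ffunE.
set A := step_bound K p q H d; set B := depth_bound q H d.
(* The remaining chain obeys the bounds for [m]; the root step and the cost of one right-hand side
   complete those for [m.+1]. *)
have [|||||||kN uD] := @gt_pop_ps_bounded f ls sigma d e p q _ _ _ _ _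
    (m * A.+1) (d.+1 + m * B) _ r H (depthH lr) (Rpop lr) k' u.
- exact: RC lr.
- by move=> i; rewrite -wsE.
- by move=> i; rewrite -wsE; apply: wsd.
- by move=> i; rewrite -wsE; apply: wse.
- by move=> g /rank_lt; apply: low.
- move=> g ws' e' fg ws'nf ws'd ws'e lt; apply: IH => //.
    by rewrite -(rank_eq fg).
  move: wsm; rewrite ltnS; apply: leq_trans; apply: mul_rank_lt.
  + by rewrite !size_map -cardE (leq_trans (max_card _)) // card_ord.
  + move=> _ /mem_map_In[t tN <-]; have [i] := In_map tN.
    by rewrite mem_enum inE => iN ->; apply: ws'd.
  + by rewrite wsE'.
- by rewrite -vE.
split; first by rewrite mulSn; move: kN; rewrite -/A; lia.
by move=> /uD; rewrite -/B mulSn; lia.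
Qed.

Lemma rank_bounded n g :
  rank g < n -> call_bounded (call_steps K H n) (call_depth K H n) g.
Proof.
elim: n g => // n IH g.
rewrite ltnS leq_eqVlt => /predU1P[gn|gn] ws d e nf wsd wse.
  apply: bounded_le (chain_bounded IH gn nf wsd wse (leqnn _)).
    by apply: leq_trans (leq_addl _ _); rewrite leq_mul2r ltnS mul_rank_le orbT.
  rewrite leq_add2r; apply: leq_trans (leq_addl _ _); rewrite leq_add2l.
  by rewrite leq_mul2r ltnS mul_rank_le orbT.
apply: bounded_le (IH g gn ws d e nf wsd wse); first exact: leq_addr.
by rewrite leq_add2r leq_addr.
Qed.

End PathOrder.

(** * The polynomial bound on the height *)

Lemma rhs_depth_bound (F : signature) (R : trs F) :
  exists H, forall l r, List.In (l, r) R -> depth r <= H.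
Proof.
elim: R => [|[l r] R [H RH]]; first by exists 0.
exists (maxn (depth r) H) => l' r' [[_ <-]|/RH rH]; first exact: leq_maxl.
by apply: leq_trans rH (leq_maxr _ _).
Qed.

(** Excluded middle decides whether a derivation of length [N.+1] exists; descending from the bound
    finds the maximal length. *)
Lemma bounded_height (F : signature) (R : trs F) (t : term F) N :
  (forall n u, innermost_steps R n t u -> n <= N) ->
  exists2 h, is_innermost_height R t h & h <= N.
Proof.
elim: N => [|N IH] tN.
  exists 0 => //; split=> //; exists t; exact: innermost_steps0.
have [[u tu]|noN] := classic (exists u, innermost_steps R N.+1 t u).
  by exists N.+1 => //; split=> //; exists u.
have [|h hh hN] := IH; last by exists h => //; apply: leqW.
move=> n u tu; have := tN n u tu; rewrite leq_eqVlt => /predU1P[nN|//].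
by case: noN; exists u; rewrite -nN.
Qed.

Theorem theorem8p5 (F : signature) (R : trs F) :
  exists p : {poly nat},
    forall (S : safe_mapping F) (P : precedence F),
      admissible P ->
      constructors_not_above_defined P ->
      predicative_recursive S P R ->
      forall (f : F) (us : {ffun 'I_(arity f) -> term F}),
        basic (App f us) ->
        exists h : nat,
          is_innermost_height R (App f us) h /\
          h <= p.[(\max_(i | i \notin safe S f) depth (us i))%N]%R.
Proof.
have [H RH] := rhs_depth_bound R.
pose K := \max_(f : F) arity f.
have [p pE] := poly_bounded_horner (poly_bounded_call_steps K H #|F|.+1).
(* [p] is built from [H], [K] and [#|F|.+1] alone, so it serves every safe mapping and precedence;
   all ranks are at most [#|F|]. *)
exists p => S P Padm PC [RC Rpop] f us /andP[_ /forallP usV].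
set d := \max_(i | _) _.
have [|h hh hN] := @bounded_height F R (App f us) (call_steps K H #|F|.+1 d).
  move=> n u fu.
  have arityK (g : F) : arity g <= K by apply: (bigmax_sup g).
  have := @rank_bounded F R S P RC Padm PC K arityK H RH Rpop #|F|.+1 f.
  (* The bound on the safe arguments affects only the depth of the result, so it vanishes from the
     step count. *)
  case/(_ _ us d (\max_i depth (us i)) _ _ _ n u fu) => //.
  - by rewrite ltnS max_card.
  - by move=> i; apply: value_normal_form.
  - by move=> i iN; apply: (bigmax_sup i).
  - by move=> i _; apply: (bigmax_sup i).
by exists h; split=> //; apply: leq_trans hN (pE d).
Qed.
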